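(* Let $W\subset\mathbb{R}^n$ be a simply-connected open set with coordinates $x^1,\dots,x^n$, and let $S=(S_{ij})$ be a smooth $n\times n$ matrix of real-valued functions on $W$, nondegenerate at every point of $W$, such that for every $i$ the entries $S_{i1},\dots,S_{in}$ of the $i$-th row are functions of $x^i$ only. Let $V_1(x^1),\dots,V_n(x^n)$ be smooth real-valued functions of the indicated variables, and let $\check H_1,\dots,\check H_n$ be the differential operators associated with $S$ and $V_1,\dots,V_n$ (defined in the context). Let $E_1,\dots,E_n$ be arbitrary real (or complex) numbers. Suppose that $\psi_1(x^1),\dots,\psi_n(x^n)$ are functions of the indicated variables such that for every $\alpha=1,\dots,n$ the function $\psi_\alpha(x^\alpha)$ satisfies the ODE $$\left(S_{\alpha1}E_1+S_{\alpha2}E_2+\cdots+S_{\alpha n}E_n\right)\psi_\alpha(x^\alpha)=\left[\left(\frac{d}{dx^\alpha}\right)^2+V_\alpha(x^\alpha)\right]\psi_\alpha(x^\alpha).$$ Then the function $$\Psi(x^1,\dots,x^n)=\prod_{\alpha=1}^n\psi_\alpha(x^\alpha)$$ satisfies the system $$\check H_i\Psi=E_i\Psi,\qquad i=1,\dots,n.$$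
   Context: Let $p_1,\dots,p_n$ be the momenta corresponding to $x^1,\dots,x^n$ on $T^*W$. The Stäckel construction associates to $S$ the functions $H_1,\dots,H_n:T^*W\to\mathbb{R}$ determined by the linear system $$S\,(H_1,\dots,H_n)^\top=(p_1^2,\dots,p_n^2)^\top .$$ They are quadratic in the momenta, and $H_{(\alpha)}^{ij}$ denotes the symmetric tensor with $H_\alpha=\sum_{i,j}H_{(\alpha)}^{ij}p_ip_j$. In the coordinates $x^i$ it is diagonal, with $H_{(\alpha)}^{ii}=(S^{-1})_{\alpha i}$ and $H_{(\alpha)}^{ij}=0$ for $i\neq j$. With $\phi:=\det(S)$, the operators $\hat H_\alpha$ act on functions $f$ on $W$ by $$\hat H_\alpha f=\sum_{i,j=1}^n\frac1\phi\frac{\partial}{\partial x^i}\left(H_{(\alpha)}^{ij}\,\phi\,\frac{\partial f}{\partial x^j}\right),\qquad \alpha=1,\dots,n.$$ The functions $U_1,\dots,U_n:W\to\mathbb{R}$ are determined by $$S\,(U_1,\dots,U_n)^\top=(V_1(x^1),\dots,V_n(x^n))^\top ,$$ and $\check H_i:=\hat H_i+U_i$ for $i=1,\dots,n$, where $U_i$ acts by multiplication. *)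

(* Defs.v *)
From HB Require Import structures.
From mathcomp Require Import all_boot all_order all_algebra.
From mathcomp Require Import complex.
From mathcomp Require Import all_classical all_reals all_analysis.

Set Implicit Arguments.
Unset Strict Implicit.
Unset Printing Implicit Defensive.

Import Order.TTheory GRing.Theory Num.Theory.
Import numFieldNormedType.Exports.

Local Open Scope classical_set_scope.
Local Open Scope ring_scope.

Section SimplyConnected.
Variables (R : realType) (T : topologicalType).
Implicit Types (W : set T) (g : R -> T).

Definition path_in W g :=
  {within `[0, 1]%classic, continuous g} /\
  (forall t, t \in `[0, 1] -> W (g t)).

(* Homotopy with fixed endpoints; the first argument of [h] is the deformation
   parameter. *)
Definition null_homotopic_in W g :=
  exists h : R * R -> T,
    [/\ {within `[0, 1]%classic `*` `[0, 1]%classic, continuous h},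
        (forall s t, s \in `[0, 1] -> t \in `[0, 1] -> W (h (s, t))),
        (forall t, t \in `[0, 1] -> h (0, t) = g t /\ h (1, t) = g 0) &
        (forall s, s \in `[0, 1] -> h (s, 0) = g 0 /\ h (s, 1) = g 0)].

Definition path_connected W :=
  forall x y, W x -> W y ->
    exists g, [/\ path_in W g, g 0 = x & g 1 = y].

Definition simply_connected W :=
  path_connected W /\
  forall g, path_in W g -> g 0 = g 1 -> null_homotopic_in W g.

End SimplyConnected.

Section Smooth.
Variables (R : realType) (n : nat).
Implicit Types (W : set 'rV[R]_n) (i : 'I_n).

Definition partial i (f : 'rV[R]_n -> R) : 'rV[R]_n -> R :=
  fun x => 'D_(delta_mx 0 i) f x.

(* Meaningful for open [W]: iterated partial derivatives of every order exist
   and are continuous at the points of [W]. *)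
Definition smooth_on W (f : 'rV[R]_n -> R) :=
  forall (s : seq 'I_n) (x : 'rV[R]_n), W x ->
    {for x, continuous (foldr partial f s)} /\
    (forall i, derivable (foldr partial f s) x (delta_mx 0 i)).

Definition smooth1_on (I : set R) (f : R -> R) :=
  forall (k : nat) (t : R), I t -> derivable (derive1n k f) t 1.

Definition coord_range W i : set R := [set x 0 i | x in W].

Definition depends_only_on W i (f : 'rV[R]_n -> R) :=
  exists g : R -> R, forall x, W x -> f x = g (x 0 i).

End Smooth.

(* Differentiation of complex-valued functions of real variables, componentwise
   on real and imaginary parts. *)
Section ComplexDerivative.
Variables (R : realType) (U : normedModType R).
Implicit Types (f : U -> R[i]) (x v : U).

Definition cderivable f x v :=
  derivable (fun y => complex.Re (f y) : R) x v /\
  derivable (fun y => complex.Im (f y) : R) x v.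

Definition cderive f x v : R[i] :=
  ('D_v (fun y => complex.Re (f y) : R) x +i*
   'D_v (fun y => complex.Im (f y) : R) x)%C.

Lemma cderivable_real (f : U -> R) x v :
  cderivable (fun y => (f y)%:C%C) x v <-> derivable f x v.
Proof. by split=> [[]|fx]//; split=> //=; exact: derivable_cst. Qed.

Lemma cderive_real (f : U -> R) x v :
  cderive (fun y => (f y)%:C%C) x v = ('D_v f x)%:C%C.
Proof. by rewrite /cderive /= derive_cst. Qed.

End ComplexDerivative.

Section Stackel.
Variables (R : realType) (n : nat).
Variable S : 'rV[R]_n -> 'M[R]_n.
Implicit Types (a i j : 'I_n) (x p : 'rV[R]_n) (f : 'rV[R]_n -> R[i]).

Definition stackel_hamiltonian a x p : R :=
  (invmx (S x) *m \col_i (p 0 i ^+ 2)) a 0.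

Definition stackel_tensor a x : 'M[R]_n := diag_mx (row a (invmx (S x))).

Lemma stackel_hamiltonian_system x p : S x \in unitmx ->
  S x *m \col_a stackel_hamiltonian a x p = \col_i (p 0 i ^+ 2).
Proof.
move=> Su; rewrite -[RHS](mulKVmx Su); congr (_ *m _).
by apply/colP => a; rewrite mxE.
Qed.

Lemma stackel_hamiltonianE a x p :
  stackel_hamiltonian a x p =
  \sum_i \sum_j stackel_tensor a x i j * p 0 i * p 0 j.
Proof.
rewrite /stackel_hamiltonian mxE; apply: eq_bigr => i _.
rewrite (bigD1 i)//= big1 => [|j ji].
  by rewrite addr0 !mxE eqxx mulr1n -mulrA -expr2.
by rewrite !mxE eq_sym (negbTE ji) mulr0n !mul0r.
Qed.

Definition stackel_flux a i j f : 'rV[R]_n -> R[i] :=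
  fun x => (stackel_tensor a x i j * \det (S x))%:C%C
           * cderive f x (delta_mx 0 j).

Definition stackel_hat a f x : R[i] :=
  \sum_i \sum_j ((\det (S x))^-1)%:C%C
                * cderive (stackel_flux a i j f) x (delta_mx 0 i).

(* All derivatives occurring in [stackel_hat a f x] exist at [x]; needed because
   [derive] is a total operator. *)
Definition stackel_hat_defined a f x :=
  (forall j, cderivable f x (delta_mx 0 j)) /\
  (forall i j, cderivable (stackel_flux a i j f) x (delta_mx 0 i)).

Variable V : 'I_n -> R -> R.

Definition stackel_potential x : 'cV[R]_n :=
  invmx (S x) *m \col_i V i (x 0 i).

Lemma stackel_potential_system x (u : 'cV[R]_n) : S x \in unitmx ->
  S x *m u = \col_i V i (x 0 i) <-> u = stackel_potential x.
Proof.
move=> Su; rewrite /stackel_potential; split=> [<-|->].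
  by rewrite mulKmx.
by rewrite mulKVmx.
Qed.

Definition stackel_check a f x : R[i] :=
  stackel_hat a f x + (stackel_potential x a 0)%:C%C * f x.

End Stackel.

Section SeparatedODE.
Variables (R : realType) (n : nat).

(* [psi] is twice differentiable at the points [x 0 a] with [x] in [W], and the
   separated equation holds there. *)
Definition solves_separated_ode (W : set 'rV[R]_n) (S : 'rV[R]_n -> 'M[R]_n)
    (v : R -> R) (E : 'I_n -> R[i]) (a : 'I_n) (psi : R -> R[i]) :=
  forall x : 'rV[R]_n, W x ->
    let t : R := x 0 a in
    let dpsi : R -> R[i] := fun s => cderive psi s 1 in
    [/\ cderivable psi t 1, cderivable dpsi t 1 &
        (\sum_j (S x a j)%:C%C * E j) * psi t
        = cderive dpsi t 1 + (v t)%:C%C * psi t].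

End SeparatedODE.

(* Main.v *)
Require Import Defs.
From HB Require Import structures.
From mathcomp Require Import all_boot all_order all_algebra.
From mathcomp Require Import complex.
From mathcomp Require Import all_classical all_reals all_analysis.

Set Implicit Arguments.
Unset Strict Implicit.
Unset Printing Implicit Defensive.

Import Order.TTheory GRing.Theory Num.Theory.
Import numFieldNormedType.Exports.

Local Open Scope classical_set_scope.
Local Open Scope ring_scope.

(** Separation of variables works here because of the shape of the Stäckel
    coefficients.  The weight [(S^-1)_(a i) * det S] is the cofactor of [S] at
    row [i] and column [a]; it does not involve the [i]-th row, and all the other
    rows depend on coordinates other than [x^i], so the weight is constant along
    the [x^i]-lines ([cofactor_eq_rows]).  It therefore comes out of the
    outer derivative, the determinants cancel, and the second order operator
    reduces on functions of separated form to
    [\sum_i (S^-1)_(a i) (d/dx^i)^2] ([is_cderive_flux_separated]).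

    On the product of the [psi_i], each second derivative acts on one factor, and
    the separated equation turns it into multiplication by
    [\sum_j S_(i j) E_j - V_i].  Summing against row [a] of [S^-1] gives back
    [E_a] from the first part ([sum_invmx_row]) and minus the potential from the
    second, which cancels the multiplication term of the full operator.

    All derivatives that occur are directional derivatives along coordinate
    axes, so they only see the restriction of a function to a short segment of a
    line inside the open set; [is_cderive_line] carries out this reduction to one
    real variable, and supplies existence and value of the derivative at
    once. *)

(** * Derivatives along a line *)

(** Existence and value are bundled, as in [is_derive], because [cderive] is
    total and each rule below has to deliver both. *)
Definition is_cderive (R : realType) (U : normedModType R) (f : U -> R[i])
    (x v : U) (d : R[i]) :=
  cderivable f x v /\ cderive f x v = d.

(** The difference quotient in the direction [v] only evaluates [f] on the line
    through [x], where it is the difference quotient of [F]. *)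
Lemma is_derive_line (R : realType) (U : normedModType R) (f : U -> R)
    (F : R -> R) (x v : U) (t d : R) :
  (\forall h \near 0, f (h *: v + x) = F (h + t)) ->
  is_derive t 1 F d -> is_derive x v f d.
Proof.
move=> fF [Ft <-].
have fxFt : f x = F t.
  by have := nbhs_singleton fF; rewrite scale0r !add0r.
have quotE : \forall h \near 0^',
    h^-1 *: ((F \o shift t) (h *: 1) - F t) =
    h^-1 *: ((f \o shift x) (h *: v) - f x).
  apply: nbhs_dnbhs; near=> h => /=.
  rewrite fxFt; congr (_ *: (_ - _)).
  by rewrite [h *: 1]mulr1 -[RHS]/(f (h *: v + x)); apply/esym; near: h.
have fx : h^-1 *: ((f \o shift x) (h *: v) - f x) @[h --> 0^'] --> 'D_1 F t.
  by apply: cvg_trans Ft; exact: near_eq_cvg.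
by split; [apply/cvg_ex; exists ('D_1 F t) | exact/cvg_lim].
Unshelve. all: by end_near. Qed.

Lemma is_cderiveP (R : realType) (U : normedModType R) (f : U -> R[i])
    (x v : U) (d : R[i]) :
  is_cderive f x v d <->
  is_derive x v (fun y => complex.Re (f y) : R) (complex.Re d) /\
  is_derive x v (fun y => complex.Im (f y) : R) (complex.Im d).
Proof.
split=> [[[? ?] <-]|[[? ReE] [? ImE]]]; first by split; exact: derivableP.
by split=> //; rewrite /cderive ReE ImE; case: d {ReE ImE}.
Qed.

Lemma is_cderive_line (R : realType) (U : normedModType R) (f : U -> R[i])
    (F : R -> R[i]) (x v : U) (t : R) (d : R[i]) :
  (\forall h \near 0, f (h *: v + x) = F (h + t)) ->
  is_cderive F t 1 d -> is_cderive f x v d.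
Proof.
move=> fF /is_cderiveP[ReF ImF]; apply/is_cderiveP; split.
  by apply: is_derive_line ReF; near=> h; congr complex.Re; near: h.
by apply: is_derive_line ImF; near=> h; congr complex.Im; near: h.
Unshelve. all: by end_near. Qed.

Lemma is_cderiveMr (R : realType) (U : normedModType R) (f : U -> R[i])
    (x v : U) (c d : R[i]) :
  is_cderive f x v d -> is_cderive (fun y => c * f y) x v (c * d).
Proof.
case: c => c1 c2 /is_cderiveP[Ref Imf]; apply/is_cderiveP; split.
  rewrite (_ : (fun y => _) = c1 \*: (fun y => complex.Re (f y) : R)
                             - c2 \*: (fun y => complex.Im (f y) : R)).
    by case: d Ref Imf => d1 d2 /= Ref Imf; exact: is_deriveB.
  by apply/funext => y; rewrite !fctE /=; case: (f y).
rewrite (_ : (fun y => _) = c1 \*: (fun y => complex.Im (f y) : R)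
                           + c2 \*: (fun y => complex.Re (f y) : R)).
  by case: d Ref Imf => d1 d2 /= Ref Imf; exact: is_deriveD.
by apply/funext => y; rewrite !fctE /=; case: (f y).
Qed.

Lemma is_cderive0 (R : realType) (U : normedModType R) (x v : U) :
  is_cderive (fun=> 0 : R[i]) x v 0.
Proof. by apply/is_cderiveP; split; exact: is_derive_cst. Qed.

(** * Separated products *)

Section SeparatedProduct.
Variables (R : realType) (n : nat).
Implicit Types (x : 'rV[R]_n) (W : set 'rV[R]_n).

Lemma coord_shift x (h : R) (i k : 'I_n) :
  (h *: delta_mx 0 i + x) 0 k = (if k == i then h + x 0 i else x 0 k).
Proof.
by rewrite !mxE eqxx /=; case: eqP => [->|_];
   rewrite ?mulr1 ?mulr0 ?add0r.
Qed.

Lemma open_near_line W x (v : 'rV[R]_n) :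
  open W -> W x -> \forall h \near 0, W ((h : R) *: v + x).
Proof.
move=> oW Wx.
have lineC : {for 0, continuous (fun h : R => h *: v + x)}.
  by apply: cvgD; [exact: scalel_continuous | exact: cvg_cst].
apply: lineC; rewrite scale0r add0r; exact: open_nbhs_nbhs.
Qed.

Lemma prod_shift (psi : 'I_n -> R -> R[i]) x h i :
  \prod_(k | k != i) psi k ((h *: delta_mx 0 i + x) 0 k) =
  \prod_(k | k != i) psi k (x 0 k).
Proof. by apply: eq_bigr => k /negbTE ki; rewrite coord_shift ki. Qed.

(** Along the [i]-th axis every factor but the [i]-th is frozen. *)
Lemma is_cderive_separated (psi : 'I_n -> R -> R[i]) x i :
  cderivable (psi i) (x 0 i) 1 ->
  is_cderive (fun y : 'rV[R]_n => \prod_k psi k (y 0 k)) x (delta_mx 0 i)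
    (\prod_(k | k != i) psi k (x 0 k) * cderive (psi i) (x 0 i) 1).
Proof.
move=> dpsi.
apply: (@is_cderive_line _ _ _
  (fun s => \prod_(k | k != i) psi k (x 0 k) * psi i s) _ _ (x 0 i)).
  near=> h.
  by rewrite (bigD1 i)//= mulrC prod_shift coord_shift eqxx.
exact: is_cderiveMr.
Unshelve. all: by end_near. Qed.

End SeparatedProduct.

(** * Cofactors and the inverse matrix *)

(** In the Leibniz expansion of the cofactor at row [i], no entry of row [i]
    occurs. *)
Lemma cofactor_eq_rows (R : comPzRingType) (n : nat) (A B : 'M[R]_n)
    (i a : 'I_n) :
  (forall k j, k != i -> A k j = B k j) -> cofactor A i a = cofactor B i a.
Proof.
move=> AB; rewrite !expand_cofactor.
apply: eq_bigr => s _; congr (_ * _); apply: eq_bigr => k.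
by rewrite eq_sym => /AB.
Qed.

Lemma sum_invmx_row (R : rcfType) (n : nat) (A : 'M[R]_n) (E : 'I_n -> R[i])
    (a : 'I_n) :
  A \in unitmx ->
  \sum_i (invmx A a i)%:C%C * (\sum_j (A i j)%:C%C * E j) = E a.
Proof.
move=> Au.
under eq_bigr do rewrite mulr_sumr.
rewrite exchange_big /=.
under eq_bigr => j _.
  under eq_bigr do rewrite mulrA -rmorphM.
  rewrite -mulr_suml -rmorph_sum.
  have -> : \sum_i invmx A a i * A i j = (a == j)%:R.
    by have := congr1 (fun M : 'M[R]_n => M a j) (mulVmx Au); rewrite !mxE.
  over.
rewrite (bigD1 a)//= eqxx mul1r big1 ?addr0// => j /negbTE ja.
by rewrite eq_sym ja rmorph0 mul0r.
Qed.

(** * Stäckel operators on separated products *)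

Section Stackel.
Variables (R : realType) (n : nat) (S : 'rV[R]_n -> 'M[R]_n).
Implicit Types (x y : 'rV[R]_n) (W : set 'rV[R]_n).

Lemma stackel_tensor_det a i x : S x \in unitmx ->
  stackel_tensor S a x i i * \det (S x) = cofactor (S x) i a.
Proof.
move=> Su; rewrite !mxE eqxx mulr1n /invmx Su !mxE mulrAC mulVf ?mul1r//.
by rewrite -unitfE -unitmxE.
Qed.

(** Near [x] on the [i]-th axis, the flux is the [i]-th cofactor weight times the
    frozen factors times [psi_i'], and only [psi_i'] varies.  Openness of [W] is
    what makes this formula for the flux valid on a whole segment.  Off the
    diagonal the flux vanishes identically. *)
Lemma is_cderive_flux_separated W (psi : 'I_n -> R -> R[i]) a i j x :
  open W -> (forall y, W y -> S y \in unitmx) ->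
  (forall k l, depends_only_on W k (fun y => S y k l)) ->
  (forall k y, W y -> cderivable (psi k) (y 0 k) 1) ->
  cderivable (fun s => cderive (psi i) s 1) (x 0 i) 1 ->
  W x ->
  is_cderive (stackel_flux S a i j (fun y => \prod_k psi k (y 0 k)))
    x (delta_mx 0 i)
    ((stackel_tensor S a x i j * \det (S x))%:C%C *
     (\prod_(k | k != i) psi k (x 0 k) *
      cderive (fun s => cderive (psi i) s 1) (x 0 i) 1)).
Proof.
move=> oW Su Srows dpsi ddpsi Wx; have [<-|ij] := eqVneq i j; last first.
  have H0 y : stackel_tensor S a y i j = 0.
    by rewrite !mxE (negbTE ij) mulr0n.
  rewrite H0 mul0r rmorph0 mul0r.
  rewrite (_ : stackel_flux _ _ _ _ _ = fun=> 0); first exact: is_cderive0.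
  by apply/funext => y; rewrite /stackel_flux H0 mul0r rmorph0 mul0r.
rewrite mulrA.
apply: (@is_cderive_line _ _ _ (fun s =>
  (stackel_tensor S a x i i * \det (S x))%:C%C *
  \prod_(k | k != i) psi k (x 0 k) * cderive (psi i) s 1) _ _ (x 0 i)).
  near=> h.
  have Wy : W (h *: delta_mx 0 i + x) by near: h; exact: open_near_line.
  rewrite /stackel_flux (is_cderive_separated (dpsi i _ Wy)).2.
  rewrite !stackel_tensor_det; [|exact: Su..].
  rewrite (@cofactor_eq_rows _ _ _ (S x)); last first.
    move=> k l /negbTE ki; have [g Sg] := Srows k l.
    by rewrite !Sg// coord_shift ki.
  by rewrite prod_shift coord_shift eqxx mulrA.
exact: is_cderiveMr.
Unshelve. all: by end_near. Qed.

End Stackel.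

Theorem theorem5 (R : realType) (n : nat) (W : set 'rV[R]_n)
    (S : 'rV[R]_n -> 'M[R]_n) (V : 'I_n -> R -> R)
    (E : 'I_n -> R[i]) (psi : 'I_n -> R -> R[i])
    (W_open : open W)
    (W_simply_connected : simply_connected R W)
    (S_smooth : forall i j, smooth_on W (fun x => S x i j))
    (S_nondegenerate : forall x, W x -> S x \in unitmx)
    (S_rows : forall i j, depends_only_on W i (fun x => S x i j))
    (V_smooth : forall i, smooth1_on (coord_range W i) (V i))
    (psi_ode : forall a, solves_separated_ode W S (V a) E a (psi a)) :
  let Psi := fun x : 'rV[R]_n => \prod_a psi a (x 0 a) in
  forall (i : 'I_n) (x : 'rV[R]_n), W x ->
    stackel_hat_defined S i Psi x /\
    stackel_check S V i Psi x = E i * Psi x.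
Proof.
move=> Psi a x Wx.
have dpsi k y : W y -> cderivable (psi k) (y 0 k) 1 by case/(psi_ode k).
have ddpsi k : cderivable (fun s => cderive (psi k) s 1) (x 0 k) 1.
  by have [] := psi_ode k x Wx.
have Su := S_nondegenerate x Wx.
have fluxD i j := is_cderive_flux_separated a j W_open S_nondegenerate
  S_rows dpsi (ddpsi i) Wx.
split.
  split=> [j|i j]; last exact: (fluxD i j).1.
  exact: (is_cderive_separated (dpsi j x Wx)).1.
rewrite /stackel_check /stackel_hat.
have detU : \det (S x) != 0 by rewrite -unitfE -unitmxE.
(* The separated equations eliminate the second derivatives, and every term
   becomes a scalar multiple of [Psi x]. *)
transitivity (\sum_i (invmx (S x) a i)%:C%C *
   ((\sum_j (S x i j)%:C%C * E j) - (V i (x 0 i))%:C%C) * Psi x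
   + (stackel_potential S V x a 0)%:C%C * Psi x).
  congr (_ + _); apply: eq_bigr => i _.
  rewrite (bigD1 i)//= big1 => [|j ji]; last first.
    rewrite (fluxD i j).2 !mxE eq_sym (negbTE ji) mulr0n mul0r rmorph0.
    by rewrite mul0r mulr0.
  rewrite addr0 (fluxD i i).2.
  have [_ _ ode] := psi_ode i x Wx.
  have {ode}-> : cderive (fun s => cderive (psi i) s 1) (x 0 i) 1 =
      (\sum_j (S x i j)%:C%C * E j - (V i (x 0 i))%:C%C) * psi i (x 0 i).
    by rewrite mulrBl ode addrK.
  rewrite mulrA -rmorphM [_^-1 * _]mulrC mulfK// !mxE eqxx mulr1n.
  rewrite [\prod_(k | k != i) _ * _]mulrCA -!mulrA; congr (_ * (_ * _)).
  by rewrite /Psi [RHS](bigD1 i)//= mulrC.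
rewrite -mulr_suml -mulrDl; congr (_ * _).
under eq_bigr do rewrite mulrBr.
rewrite sumrB sum_invmx_row// mxE rmorph_sum /=.
under [X in _ - _ + X]eq_bigr do rewrite mxE rmorphM.
by rewrite subrK.
Qed.
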